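(* Let $G_i$ be a generator over $\Sigma_i$ for $i=1,2,k$, let $L=L(G_1\|G_2\|G_k)$, and let $K\subseteq L$ be a prefix-closed language that is conditionally decomposable with respect to $\Sigma_1,\Sigma_2,\Sigma_k$. Assume that, for $i=1,2$, the projection $P_k^{i+k}$ is a $(P_i^{i+k})^{-1}(L(G_i))$-observer and is LCC for the language $(P_i^{i+k})^{-1}(L(G_i))$. Assume in addition that $L(G_k)\subseteq P_k(L)$ and that the projection $P_{i+k}$ is LCC for the language $L$, for $i=1,2$. Then $$\mathrm{supC}(K,L,\Sigma_u)=\mathrm{supcC}(K,L,(\Sigma_{1,u},\Sigma_{2,u},\Sigma_{k,u})).$$
   Context: A generator $G=(Q,\Sigma,f,q_0,Q_m)$ is a deterministic finite automaton with partial transition function; $L(G)$ is the set of words $s$ with $f(q_0,s)$ defined. Languages given as data are regular. $\overline{M}$ is the prefix closure of $M$. Let $\Sigma=\Sigma_1\cup\Sigma_2$, with $\Sigma_u\subseteq\Sigma$ the uncontrollable events, $\Sigma_{j,u}=\Sigma_j\cap\Sigma_u$ for $j=1,2,k$, and $\Sigma_{i+k,u}=(\Sigma_i\cup\Sigma_k)\cap\Sigma_u$. Projections erase events outside the target event set: $P_k:\Sigma^*\to\Sigma_k^*$, $P_{i+k}:\Sigma^*\to(\Sigma_i\cup\Sigma_k)^*$, $P_k^{i+k}:(\Sigma_i\cup\Sigma_k)^*\to\Sigma_k^*$, $P_i^{i+k}:(\Sigma_i\cup\Sigma_k)^*\to\Sigma_i^*$. The synchronous product of languages $L_i$ over $A_i$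 is the set of words over $\bigcup_iA_i$ whose projection to $A_i^*$ is in $L_i$ for every $i$; $L(G\|G')=L(G)\|L(G')$. $M\subseteq\Sigma^*$ is conditionally decomposable with respect to $\Sigma_1,\Sigma_2,\Sigma_k$, where $\Sigma_1\cap\Sigma_2\subseteq\Sigma_k\subseteq\Sigma_1\cup\Sigma_2$, if $M=P_{1+k}(M)\|P_{2+k}(M)$. $M$ is controllable with respect to a prefix-closed language $N$ and event set $U$ if $\overline{M}U\cap N\subseteq\overline{M}$. $\mathrm{supC}(K,L,\Sigma_u)$ is the supremal controllable sublanguage of $K$: the union of all languages $M\subseteq K$ controllable with respect to $L$ and $\Sigma_u$. A language $M\subseteq L(G_1\|G_2\|G_k)$ is conditionally controllable for $G_1,G_2,G_k$ and $\Sigma_{1,u},\Sigma_{2,u},\Sigma_{k,u}$ if $P_k(M)$ is controllable with respect to $L(G_k)$ and $\Sigma_{k,u}$, and for $i=1,2$, $P_{i+k}(M)$ is controllable with respect to $L(G_i)\|\overline{P_k(M)}$ and $\Sigma_{i+k,u}$. $\mathrm{supcC}(K,L,(\Sigma_{1,u},\Sigma_{2,u},\Sigma_{k,u}))$ is the largest conditionally controllable sublanguage of $K$, equal to the union of all conditionally controllable sublanguages of $K$. Let $A_0\subseteq A$ be event sets and $P:A^*\to A_0^*$ the projection. $P$ is an $M$-observer for $M\subseteq A^*$ if for all $t\in P(M)$ and $s\in\overline{M}$ such that $P(s)$ is a prefix of $t$, there is $u\in A^*$ with $su\in M$ and $P(su)=t$. $P$ is locally control consistent (LCC) for a prefix-closed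 $M\subseteq A^*$ if for every $s\in M$ and every $\sigma\in A_0\cap\Sigma_u$ with $P(s)\sigma\in P(M)$, either there is no $u\in(A\setminus A_0)^*$ with $su\sigma\in M$, or there is $u\in((A\cap\Sigma_u)\setminus A_0)^*$ with $su\sigma\in M$. *)

(* Defs.v *)
From HB Require Import structures.
From Stdlib Require List.
From mathcomp Require Import all_boot.
From mathcomp Require Import classical_sets.

Set Implicit Arguments.
Unset Strict Implicit.
Unset Printing Implicit Defensive.

Local Open Scope classical_set_scope.

(* All events live in one finite type [E]; event sets are [{set E}], words are
   [seq E], and a language over [A] is a set of words all of whose letters are
   in [A]. *)
Definition language (E : finType) := set (seq E).

Definition words (E : finType) (A : {set E}) : language E :=
  [set w | all [in A] w].

(* The partial transition function is option-valued.  It is declared on all of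
   [E], but undefined outside the alphabet [A], so [lang G] is contained in
   [words A]. *)
Record generator (E : finType) (A : {set E}) := Generator {
  state : finType;
  trans : state -> E -> option state;
  init : state;
  marked : {set state};
  trans_dom : forall q a, a \notin A -> trans q a = None }.

Section Generators.
Variables (E : finType) (A : {set E}) (G : generator A).

Fixpoint run (q : state G) (w : seq E) : option (state G) :=
  if w is a :: w' then obind (fun q' => run q' w') (trans q a) else Some q.

Definition lang : language E := [set w | run (init G) w != None].

Definition marked_lang : language E :=
  [set w | exists2 q, run (init G) w = Some q & q \in marked G].

End Generators.

Definition regular (E : finType) (A : {set E}) (M : language E) : Prop :=
  exists G : generator A, M = marked_lang G.

Section Languages.
Variable E : finType.
Implicit Types (A B U Su : {set E}) (K L M N : language E) (s t u w : seq E).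

Definition prefix_closure M : language E :=
  [set s | exists2 w, M w & prefix s w].

Definition prefix_closed M : Prop := prefix_closure M = M.

(* The projection onto [A] from any larger alphabet: the source alphabet only
   matters for inverse images, where it is an explicit argument. *)
Definition proj A w : seq E := [seq a <- w | a \in A].

Definition proj_lang A M : language E := proj A @` M.

Definition inv_proj A B M : language E := words A `&` (proj B @^-1` M).

Definition sync (Ls : seq ({set E} * language E)) : language E :=
  words (\bigcup_(p <- Ls) p.1)%SET `&`
  [set w | forall A M, List.In (A, M) Ls -> M (proj A w)].

Definition controllable M N U : Prop :=
  [set rcons s a | s in prefix_closure M & a in [set` U]] `&` N
    `<=` prefix_closure M.

Definition supC K L Su : language E :=
  \bigcup_(M in [set M | M `<=` K /\ controllable M L Su]) M.

Definition cond_decomposable (S1 S2 Sk : {set E}) M : Prop :=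
  M = sync [:: (S1 :|: Sk, proj_lang (S1 :|: Sk) M);
               (S2 :|: Sk, proj_lang (S2 :|: Sk) M)].

(* In [observer A B M] and [lcc Su A B M], the projection goes from words over
   [A] to words over [B], where [B] is a subset of [A]. *)
Definition observer A B M : Prop :=
  forall t s, proj_lang B M t -> prefix_closure M s -> prefix (proj B s) t ->
  exists u, [/\ words A u, M (s ++ u) & proj B (s ++ u) = t].

Definition lcc Su A B M : Prop :=
  forall s a, M s -> a \in B :&: Su -> proj_lang B M (rcons (proj B s) a) ->
    ~ (exists2 u, words (A :\: B) u & M (s ++ rcons u a)) \/
    (exists2 u, words ((A :&: Su) :\: B) u & M (s ++ rcons u a)).

Section Conditional.
Variables (S1 S2 Sk : {set E}).
Variables (G1 : generator S1) (G2 : generator S2) (Gk : generator Sk).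

Definition par_lang : language E :=
  sync [:: (S1, lang G1); (S2, lang G2); (Sk, lang Gk)].

Definition cond_controllable Su M : Prop :=
  [/\ M `<=` par_lang,
      controllable (proj_lang Sk M) (lang Gk) (Sk :&: Su),
      controllable (proj_lang (S1 :|: Sk) M)
        (sync [:: (S1, lang G1); (Sk, prefix_closure (proj_lang Sk M))])
        ((S1 :|: Sk) :&: Su)
    & controllable (proj_lang (S2 :|: Sk) M)
        (sync [:: (S2, lang G2); (Sk, prefix_closure (proj_lang Sk M))])
        ((S2 :|: Sk) :&: Su)].

Definition supcC K Su : language E :=
  \bigcup_(M in [set M | M `<=` K /\ cond_controllable Su M]) M.

End Conditional.
End Languages.

(* Main.v *)
(* Controllability in [L] only has to be tested along uncontrollable words.
   The observer and LCC properties together turn an abstract step [P_k(s) a]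
   into an uncontrollable local word [v a] with [v] free of events of [Sk].
   Events outside [Sk] belong to one component only, so the local words found
   in the two components can be shuffled into one uncontrollable continuation
   of [s] in [L]. Hence every controllable sublanguage has a conditionally
   controllable prefix closure. Conversely, the synchronous product of the two
   projections of a conditionally controllable sublanguage of [K] is
   controllable, and it stays in [K] by conditional decomposability. *)
Require Import Defs.
From HB Require Import structures.
From mathcomp Require Import all_boot.
From mathcomp Require Import classical_sets.

Local Open Scope classical_set_scope.

(** * Words, projections, prefix closure and controllability *)

Section Words.
Context {E : finType}.
Implicit Types (A B U : {set E}) (L M N : language E) (s t u v w : seq E).

Lemma words_cat A s t : words A (s ++ t) <-> words A s /\ words A t.
Proof. by rewrite /words /= all_cat; split=> [/andP|] [-> ->]. Qed.

Lemma words_rcons A s a : words A (rcons s a) <-> a \in A /\ words A s.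
Proof. by rewrite /words /= all_rcons; split=> [/andP|] [-> ->]. Qed.

Lemma words_sub A B w : A \subset B -> words A w -> words B w.
Proof. by move=> /fintype.subsetP AB; apply: sub_all => a; apply: AB. Qed.

Lemma proj_cat A s t : proj A (s ++ t) = proj A s ++ proj A t.
Proof. exact: filter_cat. Qed.

Lemma proj_rcons A s a :
  proj A (rcons s a) = if a \in A then rcons (proj A s) a else proj A s.
Proof. exact: filter_rcons. Qed.

Lemma words_proj A w : words A (proj A w).
Proof. exact: filter_all. Qed.

Lemma proj_nil A B w : B \subset ~: A -> words B w -> proj A w = [::].
Proof.
move=> /fintype.subsetP BA /allP Bw.
rewrite /proj (eq_in_filter (a2 := pred0)) ?filter_pred0 //.
by move=> a /Bw /BA; rewrite inE => /negPf.
Qed.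

Lemma proj_proj A B w : A \subset B -> proj A (proj B w) = proj A w.
Proof.
move=> /fintype.subsetP AB; rewrite /proj -filter_predI; apply: eq_filter => a /=.
by have [/AB ->|] := boolP (a \in A).
Qed.

Lemma prefix_closedP M :
  prefix_closed M <-> forall s t, M (s ++ t) -> M s.
Proof.
split=> [cM s t Mst | cM].
  by rewrite -cM; exists (s ++ t) => //; apply: prefix_prefix.
rewrite /prefix_closed; apply/seteqP; split=> s.
  by case=> w Mw /prefixP[t wE]; apply: (cM s t); rewrite -wE.
by move=> Ms; exists s => //; apply: prefix_refl.
Qed.

Lemma sub_prefix_closure M : M `<=` prefix_closure M.
Proof. by move=> s Ms; exists s => //; apply: prefix_refl. Qed.

Lemma prefix_closure_closed M : prefix_closed (prefix_closure M).
Proof.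
apply/prefix_closedP => s t [w Mw p]; exists w => //.
exact: prefix_trans (prefix_prefix s t) p.
Qed.

Lemma prefix_closure_sub M N : prefix_closed N -> M `<=` N ->
  prefix_closure M `<=` N.
Proof. by move=> cN MN s [w /MN Nw p]; rewrite -cN; exists w. Qed.

(** Induction on the last letter of [w]: a prefix of the projection of [rcons w a], other than the
    whole, is already a prefix of the projection of [w]. *)
Lemma proj_lang_closed A M : prefix_closed M -> prefix_closed (proj_lang A M).
Proof.
move=> /prefix_closedP cM; apply/prefix_closedP => s t [w Mw].
elim/last_ind: w Mw t => [|w a IH] Mw t /=.
  by case: s => // _; exists [::].
have Mw' : M w by apply: (cM w [:: a]); rewrite cats1.
case: (lastP t) => [|t' b]; first by rewrite cats0 => <-; exists (rcons w a).
rewrite proj_rcons; case: ifP => _ wE; last exact: (IH Mw' (rcons t' b)).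
by apply: (IH Mw' t'); move: wE; rewrite -rcons_cat => /rcons_inj[].
Qed.

Lemma prefix_closure_proj A M :
  prefix_closure (proj_lang A M) = proj_lang A (prefix_closure M).
Proof.
apply/seteqP; split; last first.
  move=> _ [s [w Mw /prefixP[t wE]] <-]; exists (proj A w); first by exists w.
  by rewrite wE proj_cat prefix_prefix.
apply: prefix_closure_sub; first exact/proj_lang_closed/prefix_closure_closed.
by move=> _ [w Mw <-]; exists w => //; apply: sub_prefix_closure.
Qed.

Lemma controllable_closure M N U :
  controllable (prefix_closure M) N U <-> controllable M N U.
Proof. by rewrite /controllable prefix_closure_closed. Qed.

Lemma controllableP M N U : prefix_closed M ->
  (controllable M N U <->
   forall s a, M s -> a \in U -> N (rcons s a) -> M (rcons s a)).
Proof.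
rewrite /controllable => ->; split=> [cM s a Ms Ua Nsa | cM _ [[s Ms [a Ua <-]]]].
  by apply: cM; split=> //; exists s => //; exists a.
exact: cM.
Qed.

(** Prefix closure of [N] keeps every intermediate word in [N], so the one-letter condition applies
    along all of [u]. *)
Lemma controllable_cat M N U s u : prefix_closed M -> prefix_closed N ->
  controllable M N U -> M s -> words U u -> N (s ++ u) -> M (s ++ u).
Proof.
move=> cM /prefix_closedP cN /(controllableP _ _ _ cM) ctr Ms.
elim/last_ind: u => [|u a IH]; first by rewrite cats0.
rewrite words_rcons -rcons_cat => -[Ua Uu] Nsua; apply: ctr => //.
by apply: IH => //; apply: (cN _ [:: a]); rewrite cats1.
Qed.

(** The observer property extends [s] to a word of [N] projecting exactly to [rcons (proj B s) a].
    This refutes the first alternative of [lcc]; the second one is the claim. *)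
Lemma observer_lcc_step Su A B N s a : prefix_closed N ->
  observer A B N -> lcc Su A B N -> N s -> a \in B :&: Su ->
  proj_lang B N (rcons (proj B s) a) ->
  exists2 v, words ((A :&: Su) :\: B) v & N (s ++ rcons v a).
Proof.
move=> /prefix_closedP cN obs lc Ns BSa Pa.
case: (lc s a Ns BSa Pa) => //; case.
have [] := obs _ s Pa; first exact: sub_prefix_closure.
  by rewrite -cats1 prefix_prefix.
move=> u [Au Nsu]; rewrite proj_cat -cats1 => /eqP.
rewrite eqseq_cat // eqxx /= => /eqP uE.
(* Trailing letters of [u] outside [B] are dropped by prefix closure until [u] ends with its only
   letter in [B], which is [a]. What precedes that letter is free of [B]. *)
elim/last_ind: u Au Nsu uE => [//|u b IH] /words_rcons[Ab Au] Nsu.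
rewrite proj_rcons; case: ifP => [Bb | _]; last first.
  by apply: IH => //; apply: (cN _ [:: b]); rewrite cats1 rcons_cat.
rewrite -[[:: a]]/(rcons [::] a) => /rcons_inj[uE ba].
exists u; last by rewrite -ba.
apply/allP => c uc; rewrite !inE (allP Au _ uc) andbT; apply/negP => Bc.
by have : c \in proj B u; [rewrite mem_filter Bc | rewrite uE].
Qed.

Lemma sync2P A B M N w : sync [:: (A, M); (B, N)] w <->
  [/\ words (A :|: B) w, M (proj A w) & N (proj B w)].
Proof.
rewrite /sync !big_cons big_nil finset.setU0 /=; split=> [[? h]|[? ? ?]].
  by split=> //; apply: h; [left | right; left].
by split=> // C P [[<- <-]|[[<- <-]|[]]].
Qed.

Lemma sync_closed A B M N : prefix_closed M -> prefix_closed N ->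
  prefix_closed (sync [:: (A, M); (B, N)]).
Proof.
move=> /prefix_closedP cM /prefix_closedP cN; apply/prefix_closedP => s t.
rewrite !sync2P !proj_cat => -[/words_cat[? _] /cM ? /cN ?].
by split.
Qed.

Lemma lang_closed A (G : generator A) : prefix_closed (lang G).
Proof.
apply/prefix_closedP => s t; rewrite /lang /=.
by elim: s (init G) => [|a s IH] q //=; case: (trans q a).
Qed.

Lemma inv_proj_closed A B M : prefix_closed M -> prefix_closed (inv_proj A B M).
Proof.
move=> /prefix_closedP cM; apply/prefix_closedP => s t [/words_cat[As _]].
by rewrite /preimage /= proj_cat => /cM.
Qed.

End Words.

(** * The composed plant and its components *)

Section Components.
Context {E : finType} {S1 S2 Sk Su : {set E}}.
Variables (G1 : generator S1) (G2 : generator S2) (Gk : generator Sk).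
Implicit Types (M : language E) (s v w : seq E).

Lemma par_langP w : par_lang G1 G2 Gk w <->
  [/\ words (S1 :|: S2 :|: Sk) w, lang G1 (proj S1 w), lang G2 (proj S2 w)
    & lang Gk (proj Sk w)].
Proof.
rewrite /par_lang /sync !big_cons big_nil finset.setU0 finset.setUA /=.
split=> [[? h]|[? ? ? ?]].
  by split=> //; apply: h; [left | right; left | right; right; left].
by split=> // C P [[<- <-]|[[<- <-]|[[<- <-]|[]]]].
Qed.

Lemma par_lang_closed : prefix_closed (par_lang G1 G2 Gk).
Proof.
have /prefix_closedP c1 := lang_closed _ G1.
have /prefix_closedP c2 := lang_closed _ G2.
have /prefix_closedP ck := lang_closed _ Gk.
apply/prefix_closedP => s t; rewrite !par_langP !proj_cat.
by case=> /words_cat[? _] /c1 ? /c2 ? /ck.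
Qed.

Lemma proj_par_lang w : par_lang G1 G2 Gk w ->
  inv_proj (S1 :|: Sk) S1 (lang G1) (proj (S1 :|: Sk) w).
Proof.
move=> /par_langP[_ L1 _ _]; split; first exact: words_proj.
by rewrite /preimage /= proj_proj // finset.subsetUl.
Qed.

(** The word [t] shows that the abstract step [a] is feasible in the first component, so
    [observer_lcc_step] lifts it. A letter of [S1 :|: Sk] outside [Sk] lies in [S1], hence [v] is
    local to [G1]. *)
Lemma component_step s t a :
  observer (S1 :|: Sk) Sk (inv_proj (S1 :|: Sk) S1 (lang G1)) ->
  lcc Su (S1 :|: Sk) Sk (inv_proj (S1 :|: Sk) S1 (lang G1)) ->
  par_lang G1 G2 Gk s -> par_lang G1 G2 Gk t -> a \in Sk :&: Su ->
  proj Sk t = rcons (proj Sk s) a ->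
  exists2 v, words ((S1 :&: Su) :\: Sk) v &
    lang G1 (proj S1 s ++ proj S1 (rcons v a)).
Proof.
move=> obs lc Ls Lt Skua tE.
have sk : Sk \subset S1 :|: Sk by exact: finset.subsetUr.
have s1 : S1 \subset S1 :|: Sk by exact: finset.subsetUl.
have [||v vw [_]] := observer_lcc_step Su _ _ _ _ a _ obs lc (proj_par_lang s Ls) Skua.
- exact/inv_proj_closed/lang_closed.
- exists (proj (S1 :|: Sk) t); first exact: proj_par_lang.
  by rewrite !proj_proj.
rewrite /preimage /= proj_cat proj_proj // => L1; exists v => //.
apply: words_sub vw; apply/fintype.subsetP => b; rewrite !inE.
by case: (b \in Sk) => //=; rewrite orbF.
Qed.

End Components.

(** Transfers statements about the first component to the second. *)
Lemma par_langC (E : finType) (S1 S2 Sk : {set E}) (G1 : generator S1)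
    (G2 : generator S2) (Gk : generator Sk) :
  par_lang G1 G2 Gk = par_lang G2 G1 Gk.
Proof.
by apply/seteqP; split=> w; rewrite !par_langP (finset.setUC S1) => -[].
Qed.

(** * Controllability of projections and of their synchronous product *)

Section Controllability.
Context {E : finType} {S1 S2 Sk Su : {set E}}.
Variables (G1 : generator S1) (G2 : generator S2) (Gk : generator Sk).
Variable M : language E.
Hypothesis M_closed : prefix_closed M.
Hypothesis M_sub : M `<=` par_lang G1 G2 Gk.

Lemma proj_coordinator_controllable :
  S1 :&: S2 \subset Sk ->
  lang Gk `<=` proj_lang Sk (par_lang G1 G2 Gk) ->
  observer (S1 :|: Sk) Sk (inv_proj (S1 :|: Sk) S1 (lang G1)) ->
  observer (S2 :|: Sk) Sk (inv_proj (S2 :|: Sk) S2 (lang G2)) ->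
  lcc Su (S1 :|: Sk) Sk (inv_proj (S1 :|: Sk) S1 (lang G1)) ->
  lcc Su (S2 :|: Sk) Sk (inv_proj (S2 :|: Sk) S2 (lang G2)) ->
  controllable M (par_lang G1 G2 Gk) Su ->
  controllable (proj_lang Sk M) (lang Gk) (Sk :&: Su).
Proof.
move=> S12 hGk obs1 obs2 lcc1 lcc2 ctr.
apply/controllableP; first exact: proj_lang_closed.
move=> _ a [s Ms <-] Skua Gksa; have Ls := M_sub _ Ms.
(* A step allowed by the coordinator is realised by a plant word [t], which serves both
   components. *)
have [t Lt tE] := hGk _ Gksa.
have [v1 w1 L1] := component_step _ _ _ _ _ _ obs1 lcc1 Ls Lt Skua tE.
rewrite par_langC in Ls Lt.
have [v2 w2 L2] := component_step _ _ _ _ _ _ obs2 lcc2 Ls Lt Skua tE.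
rewrite par_langC in Ls Lt.
move: Skua; rewrite !inE => /andP[Ska Sua].
have dk A : A :\: Sk \subset ~: Sk by rewrite finset.setDE finset.subsetIr.
(* Shared events lie in [Sk], so a local word of one component is erased by the projection to the
   other. *)
have dA (A B : {set E}) : A :&: B \subset Sk -> (B :&: Su) :\: Sk \subset ~: A.
  move=> /fintype.subsetP AB; apply/fintype.subsetP => b; rewrite !inE.
  case/and3P=> /negP bk bB _; apply/negP => bA; apply: bk.
  by apply: AB; rewrite inE bA.
have d12 := dA _ _ S12; have d21 : (S1 :&: Su) :\: Sk \subset ~: S2.
  by apply: dA; rewrite finset.setIC.
have kE : proj Sk (s ++ v1 ++ rcons v2 a) = rcons (proj Sk s) a.
  rewrite !proj_cat proj_rcons Ska (proj_nil _ _ v1 (dk _) w1).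
  by rewrite (proj_nil _ _ v2 (dk _) w2) cats1.
(* [G1] sees [v1] but not [v2], [G2] sees [v2] but not [v1], and the coordinator sees neither. The
   continuation is uncontrollable, so it stays in [M]. *)
exists (s ++ v1 ++ rcons v2 a) => //.
have u1 : words Su v1.
  apply: words_sub w1; apply/fintype.subsetP => b.
  by rewrite !inE => /and3P[].
have u2 : words Su v2.
  apply: words_sub w2; apply/fintype.subsetP => b.
  by rewrite !inE => /and3P[].
apply: controllable_cat M_closed (par_lang_closed _ _ _) ctr Ms _ _.
  by rewrite words_cat words_rcons.
apply/par_langP; split; last by rewrite kE.
- move: Ls => /par_langP[ws _ _ _].
  rewrite !words_cat words_rcons; do !split => //.
  + apply: words_sub w1; apply/fintype.subsetP => b.
    by rewrite !inE => /and3P[_ -> _].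
  + by rewrite !inE Ska orbT.
  + apply: words_sub w2; apply/fintype.subsetP => b.
    by rewrite !inE => /and3P[_ -> _]; rewrite orbT.
- move: L1; rewrite !proj_cat !proj_rcons (proj_nil _ _ v2 d12 w2).
  by case: ifP; rewrite ?cats0 // -cats1 /= -?cats1.
- by move: L2; rewrite !proj_cat (proj_nil _ _ v1 d21 w1).
Qed.

(** [G1] and the coordinator already accept [a] after [s]. Only [G2] may first have to perform an
    uncontrollable word [v], and [v] is invisible to [S1 :|: Sk]. *)
Lemma proj_component_controllable :
  S1 :&: S2 \subset Sk ->
  observer (S2 :|: Sk) Sk (inv_proj (S2 :|: Sk) S2 (lang G2)) ->
  lcc Su (S2 :|: Sk) Sk (inv_proj (S2 :|: Sk) S2 (lang G2)) ->
  controllable M (par_lang G1 G2 Gk) Su ->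
  controllable (proj_lang (S1 :|: Sk) M)
    (sync [:: (S1, lang G1); (Sk, prefix_closure (proj_lang Sk M))])
    ((S1 :|: Sk) :&: Su).
Proof.
move=> S12 obs2 lcc2 ctr; rewrite prefix_closure_proj M_closed.
apply/controllableP; first exact: proj_lang_closed.
have sk : Sk \subset S1 :|: Sk by exact: finset.subsetUr.
have s1 : S1 \subset S1 :|: Sk by exact: finset.subsetUl.
move=> _ a [s Ms <-] /setIP[S1ka Sua] /sync2P[_].
have Ls := M_sub _ Ms; have /par_langP[ws L1 L2 Lk] := Ls.
rewrite !proj_rcons !proj_proj // => L1a [t Mt tE].
suff [v [vu vk vL]] : exists v, [/\ words (S2 :&: Su) v, words (~: Sk) v &
    lang G2 (proj S2 (s ++ rcons v a))].
  have v1 : words (~: (S1 :|: Sk)) v.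
    apply/allP => b bv; have := allP vu _ bv; have := allP vk _ bv.
    rewrite !inE => /negP bk /andP[b2 _]; apply/negP => /orP[b1|//].
    by apply: bk; apply: (fintype.subsetP S12); rewrite inE b1.
  have v0 (A : {set E}) : A \subset S1 :|: Sk -> proj A v = [::].
    by move=> sA; apply: proj_nil v1; rewrite finset.setCS.
  exists (s ++ rcons v a).
    apply: controllable_cat M_closed (par_lang_closed _ _ _) ctr Ms _ _.
      rewrite words_rcons; split=> //; apply: words_sub vu.
      exact: finset.subsetIr.
    apply/par_langP; split => //.
    + rewrite words_cat words_rcons; do !split=> //.
        by move: S1ka; rewrite !inE => /orP[]->; rewrite ?orbT.
      apply: words_sub vu; apply/fintype.subsetP => b.
      by rewrite !inE => /andP[-> _]; rewrite orbT.
    + by rewrite -rcons_cat proj_rcons proj_cat v0 // cats0.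
    + rewrite -rcons_cat proj_rcons proj_cat v0 // cats0 -tE.
      by have /par_langP[] := M_sub _ Mt.
  by rewrite -rcons_cat proj_rcons S1ka proj_cat v0 // cats0.
(* For [a] in [Sk], the word [t] of [M] gives the abstract step that [G2] has to match. Otherwise
   [a] is private to [G1] and the empty [v] works. *)
have [Ska | nSka] := boolP (a \in Sk).
  have Skua : a \in Sk :&: Su by rewrite inE Ska.
  have Lt := M_sub _ Mt; rewrite Ska in tE.
  rewrite par_langC in Ls Lt.
  have [v vw vL] := component_step _ _ _ _ _ _ obs2 lcc2 Ls Lt Skua tE.
  exists v; rewrite proj_cat; split=> //; apply: words_sub vw.
    exact: finset.subsetDl.
  by rewrite finset.setDE finset.subsetIr.
exists [::]; split=> //; rewrite cats1 proj_rcons ifN //.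
apply: contra (nSka) => a2; apply: (fintype.subsetP S12); rewrite inE a2 andbT.
by move: S1ka nSka; rewrite inE => /orP[//|->].
Qed.

(** An uncontrollable plant step is followed first in the coordinator, then in each component that
    sees it; a projection that erases [a] does not move. *)
Lemma sync_proj_controllable :
  cond_controllable G1 G2 Gk Su M ->
  controllable (sync [:: (S1 :|: Sk, proj_lang (S1 :|: Sk) M);
                         (S2 :|: Sk, proj_lang (S2 :|: Sk) M)])
    (par_lang G1 G2 Gk) Su.
Proof.
have pcl A : prefix_closed (proj_lang A M) by exact: proj_lang_closed.
have cP A := controllableP (proj_lang A M) _ _ (pcl A).
case=> _; rewrite !pcl => /cP ctrk /cP ctr1 /cP ctr2.
apply/controllableP; first exact: sync_closed.
move=> s a /sync2P[ws P1 P2] Sua /par_langP[wsa L1 L2 Lk].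
have sk (A : {set E}) : Sk \subset A :|: Sk by exact: finset.subsetUr.
have sl (A : {set E}) : A \subset A :|: Sk by exact: finset.subsetUl.
(* Needed first, since the component conditions are relative to a plant that contains
   [proj_lang Sk M]. *)
have Mk : proj_lang Sk M (proj Sk (rcons s a)).
  have Pk : proj_lang Sk M (proj Sk s).
    by case: P1 => t Mt tE; exists t => //; rewrite -(proj_proj _ _ _ (sk S1)) tE proj_proj.
  move: Lk; rewrite proj_rcons; case: ifP => // Ska Lk.
  by apply: ctrk => //; rewrite inE Ska.
have step (A : {set E}) (G : generator A) :
    (forall s a, proj_lang (A :|: Sk) M s -> a \in (A :|: Sk) :&: Su ->
      sync [:: (A, lang G); (Sk, proj_lang Sk M)] (rcons s a) ->
      proj_lang (A :|: Sk) M (rcons s a)) ->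
    lang G (proj A (rcons s a)) -> proj_lang (A :|: Sk) M (proj (A :|: Sk) s) ->
    proj_lang (A :|: Sk) M (proj (A :|: Sk) (rcons s a)).
  move=> ctr LA PA; have := words_proj (A :|: Sk) (rcons s a).
  rewrite -(proj_proj _ _ _ (sl A)) in LA.
  move: Mk LA; rewrite -(proj_proj _ _ _ (sk A)).
  rewrite (proj_rcons (A :|: Sk)); case: ifP => // Aa Mk LA wA.
  by apply: ctr => //; [rewrite inE Aa | apply/sync2P; split].
apply/sync2P; split.
- apply: words_sub wsa; apply/fintype.subsetP => b; rewrite !inE.
  by do 3!case: (b \in _).
- by apply: (step S1 G1) => //; apply: ctr1.
- by apply: (step S2 G2) => //; apply: ctr2.
Qed.

End Controllability.

(** Closure commutes with projection and controllability depends only on the closure; the plant is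
    itself prefix-closed. *)
Lemma cond_controllable_closure (E : finType) (S1 S2 Sk Su : {set E})
    (G1 : generator S1) (G2 : generator S2) (Gk : generator Sk)
    (M : language E) :
  cond_controllable G1 G2 Gk Su M ->
  cond_controllable G1 G2 Gk Su (prefix_closure M).
Proof.
case=> ML ck c1 c2; split.
- by apply: prefix_closure_sub => //; apply: par_lang_closed.
all: by rewrite -!prefix_closure_proj ?prefix_closure_closed controllable_closure.
Qed.

(** * Equality of the two supremal sublanguages *)

Theorem theorem11 (E : finType) (S1 S2 Sk Su : {set E})
  (G1 : generator S1) (G2 : generator S2) (Gk : generator Sk)
  (K : language E)
  (hSu : Su \subset S1 :|: S2)
  (hSk_lower : S1 :&: S2 \subset Sk)
  (hSk_upper : Sk \subset S1 :|: S2)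
  (hK_regular : regular (S1 :|: S2) K)
  (hK_sub : K `<=` par_lang G1 G2 Gk)
  (hK_closed : prefix_closed K)
  (hK_decomposable : cond_decomposable S1 S2 Sk K)
  (hobs1 : observer (S1 :|: Sk) Sk (inv_proj (S1 :|: Sk) S1 (lang G1)))
  (hobs2 : observer (S2 :|: Sk) Sk (inv_proj (S2 :|: Sk) S2 (lang G2)))
  (hlcc1 : lcc Su (S1 :|: Sk) Sk (inv_proj (S1 :|: Sk) S1 (lang G1)))
  (hlcc2 : lcc Su (S2 :|: Sk) Sk (inv_proj (S2 :|: Sk) S2 (lang G2)))
  (hGk : lang Gk `<=` proj_lang Sk (par_lang G1 G2 Gk))
  (hlccL1 : lcc Su (S1 :|: S2) (S1 :|: Sk) (par_lang G1 G2 Gk))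
  (hlccL2 : lcc Su (S1 :|: S2) (S2 :|: Sk) (par_lang G1 G2 Gk)) :
  supC K (par_lang G1 G2 Gk) Su = supcC G1 G2 Gk K Su.
Proof.
apply/seteqP; split=> w [M [MK ctr] Mw]; last first.
  pose M0 := prefix_closure M.
  have M0_closed : prefix_closed M0 by exact: prefix_closure_closed.
  have M0K : M0 `<=` K by exact: prefix_closure_sub.
  have M0w : M0 w by exact: sub_prefix_closure.
  (* This product contains [M0]. It lies in [K] because its two projections come from words of [K]
     and [K] is decomposable. *)
  exists (sync [:: (S1 :|: Sk, proj_lang (S1 :|: Sk) M0);
                   (S2 :|: Sk, proj_lang (S2 :|: Sk) M0)]).
    split; last exact/sync_proj_controllable/cond_controllable_closure.
    move=> s /sync2P[ws [t1 /M0K Kt1 t1E] [t2 /M0K Kt2 t2E]].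
    rewrite hK_decomposable; apply/sync2P.
    by split=> //; [exists t1 | exists t2].
  apply/sync2P; split; [|by exists w|by exists w].
  have /par_langP[ww _ _ _] := hK_sub _ (M0K _ M0w).
  apply: words_sub ww; apply/fintype.subsetP => b; rewrite !inE.
  by do 3!case: (b \in _).
(* Conversely, the closure of a controllable [M] stays in the prefix-closed [K] and is conditionally
   controllable. *)
exists (prefix_closure M); last exact: sub_prefix_closure.
have M0K : prefix_closure M `<=` K by exact: prefix_closure_sub.
have M0_closed : prefix_closed (prefix_closure M) by exact: prefix_closure_closed.
have M0L := subset_trans M0K hK_sub.
move/controllable_closure: ctr => ctr.
split=> //; split=> //.
- exact: proj_coordinator_controllable ctr.
- exact: proj_component_controllable ctr.
(* The second component follows by exchanging the roles of [G1] and [G2]. *)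
- rewrite par_langC in M0L ctr; rewrite finset.setIC in hSk_lower.
  exact: proj_component_controllable ctr.
Qed.
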